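(* Let $0<T\le\infty$. For all $\xi,\tilde\xi\in S([0,T])$, $$\|\tau_+^{-1}(\cdot;\xi)-\tau_+^{-1}(\cdot;\tilde\xi)\|_{\infty[0,T]}\le\|\xi-\tilde\xi\|_{\infty[0,T]}\quad\text{and}\quad \|\tau_-^{-1}(\cdot;\xi)-\tau_-^{-1}(\cdot;\tilde\xi)\|_{\infty[0,T]}\le\|\xi-\tilde\xi\|_{\infty[0,T]}.$$ Furthermore, the constant $C=1$ is the best-possible Lipschitz constant: neither inequality holds for all $\xi,\tilde\xi\in S([0,T])$ with the right-hand side replaced by $C\|\xi-\tilde\xi\|_{\infty[0,T]}$ for some $C<1$.
   Context: For $T=\infty$, $[0,T]$ is understood as $[0,\infty)$; $\|\cdot\|_{\infty[0,T]}$ is the sup norm. A driver is a continuous function $\xi:[0,T]\to\mathbb{R}$. The upwards Loewner flow of $\xi$ in the upper half plane $\mathbb{H}$ is the solution of $\partial_t h_t(z)=\frac{-2}{h_t(z)-\xi(t)}$, $h_0(z)=z$; for $z\in\mathbb{H}$ it exists on all of $[0,T]$. Hitting times: for $x\in\mathbb{R}\setminus\{\xi(0)\}$, let $x(t)=h_t(x;\xi)$ be the real solution of the same ODE started at $x$, and let $\tau(x;\xi):=\inf\{t\ge 0: \liminf_{s\nearrow t}|x(s)-\xi(s)|=0\}$ (with $t\in[0,T]$ and $\inf\emptyset=+\infty$); also $\tau(\xi(0);\xi)=0$. Simple-curve drivers: for $T<\infty$, $S([0,T])$ is the set of continuous $\xi:[0,T]\to\mathbb{R}$ that generate a simple curve,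 i.e. there is an injective continuous $\gamma:[0,T]\to\mathbb{H}\cup\{\xi(T)\}$ with $\gamma(0)=\xi(T)$ and $\gamma((0,T])\subset\mathbb{H}$ such that $h_T$ maps $\mathbb{H}$ conformally onto $\mathbb{H}\setminus\gamma((0,T])$. For $T=\infty$, $\xi\in S([0,\infty))$ means $\xi|_{[0,T']}\in S([0,T'])$ for all finite $T'$. For $\xi\in S([0,T])$, $\tau(\cdot;\xi)$ restricted to the set where it is finite is continuous, strictly decreasing on the part $x\le\xi(0)$ and strictly increasing on the part $x\ge\xi(0)$, with each (finite) value $t\in[0,T]$ attained exactly once on each part. Let $\tau_-$ and $\tau_+$ denote these restrictions to $x\le\xi(0)$ and $x\ge\xi(0)$, and $\tau_\pm^{-1}(\cdot;\xi):[0,T]\to\mathbb{R}$ their inverses; thus $\tau_\pm^{-1}(0;\xi)=\xi(0)$. *)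

(* Defs.v *)
From HB Require Import structures.
From mathcomp Require Import all_boot all_order all_algebra.
From mathcomp Require Import all_classical all_reals all_analysis.
From mathcomp Require Import complex.

Set Implicit Arguments.
Unset Strict Implicit.
Unset Printing Implicit Defensive.

Import Order.TTheory GRing.Theory Num.Theory.
Import numFieldNormedType.Exports.

Local Open Scope classical_set_scope.
Local Open Scope ring_scope.
Local Open Scope complex_scope.

(* R[i] seen through an abstract structure, so that it inherits the canonical
   topology and norm of a numFieldType. *)
Definition Cplx (R : realType) : numClosedFieldType := R[i].

Definition upper_half_plane (R : realType) : set (Cplx R) :=
  [set z : Cplx R | 0 < complex.Im z].

(* A driver on [0,T] is represented by a total function R -> R; only its
   values on the following set matter. *)
Definition time_set (R : realType) (T : \bar R) : set R :=
  [set t : R | (0 <= t) && (t%:E <= T)%E].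

Definition sup_norm (R : realType) (T : \bar R) (f : R -> R) : \bar R :=
  ereal_sup [set `|f t|%:E | t in time_set T].

(* Time derivatives relative to a set A of times; they are one-sided at an end
   point of an interval A. *)
Definition real_deriv_within (R : realType) (A : set R) (u : R -> R)
    (t l : R) : Prop :=
  (u s - u t) / (s - t) @[s --> within A (t^')] --> l.

Definition cplx_deriv_within (R : realType) (A : set R) (u : R -> Cplx R)
    (t : R) (l : Cplx R) : Prop :=
  (u s - u t) / ((s - t)%:C : Cplx R) @[s --> within A (t^')] --> l.

Definition upward_flow (R : realType) (T : R) (xi : R -> R)
    (h : R -> Cplx R -> Cplx R) : Prop :=
  forall z : Cplx R, upper_half_plane z ->
    h 0 z = z /\
    forall t : R, 0 <= t <= T ->
      h t z <> (xi t)%:C /\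
      cplx_deriv_within `[0, T] (h ^~ z) t (- 2 / (h t z - (xi t)%:C)).

Definition conformal_onto (R : realType) (A B : set (Cplx R))
    (f : Cplx R -> Cplx R) : Prop :=
  set_bij A B f /\ forall z : Cplx R, A z -> derivable f z 1.

Definition simple_curve_driver_fin (R : realType) (T : R) (xi : R -> R) :
    Prop :=
  {within `[0, T], continuous xi} /\
  exists (h : R -> Cplx R -> Cplx R) (gamma : R -> Cplx R),
    [/\ upward_flow T xi h,
        {within `[0, T], continuous gamma} /\ set_inj `[0, T] gamma,
        gamma 0 = (xi T)%:C,
        forall t : R, 0 < t <= T -> upper_half_plane (gamma t)
      & conformal_onto (@upper_half_plane R)
          (@upper_half_plane R `\` gamma @` `]0, T]) (h T)].

Definition simple_curve_driver (R : realType) (T : \bar R) (xi : R -> R) :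
    Prop :=
  match T with
  | EFin r => simple_curve_driver_fin r xi
  | +oo%E => forall r : R, 0 < r -> simple_curve_driver_fin r xi
  | -oo%E => False
  end.

(* Solution on [0,t[ of x' = -2/(x - xi) started at x.  The inequality u <> xi
   is part of being a solution, since 1/0 = 0 by convention. *)
Definition real_solution (R : realType) (xi : R -> R) (x t : R)
    (u : R -> R) : Prop :=
  u 0 = x /\
  forall s : R, 0 <= s < t ->
    u s <> xi s /\
    real_deriv_within `[0, t[ u s (- 2 / (u s - xi s)).

(* As solutions are unique, the set below has at most one element.  Its
   ereal_inf is +oo when it is empty. *)
Definition hitting_time (R : realType) (T : \bar R) (xi : R -> R) (x : R) :
    \bar R :=
  if x == xi 0 then 0%E else
  ereal_inf [set t%:E | t in [set t : R | [/\ 0 < t, (t%:E <= T)%E &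
    exists2 u : R -> R, real_solution xi x t u &
      limf_einf (fun s : R => `|u s - xi s|%:E) (t^'-) = 0%E]]].

(* f is the inverse, on the time set [0,T], of the restriction of the hitting
   time to D. *)
Definition hitting_time_inverse (R : realType) (T : \bar R) (xi : R -> R)
    (D : set R) (f : R -> R) : Prop :=
  forall t : R, time_set T t ->
    [/\ D (f t), hitting_time T xi (f t) = t%:E
      & forall x : R, D x -> hitting_time T xi x = t%:E -> x = f t].

Definition tau_plus_inverse (R : realType) (T : \bar R) (xi f : R -> R) :
    Prop :=
  hitting_time_inverse T xi [set x | xi 0 <= x] f.

Definition tau_minus_inverse (R : realType) (T : \bar R) (xi f : R -> R) :
    Prop :=
  hitting_time_inverse T xi [set x | x <= xi 0] f.

(* Main.v *)
Require Import Defs.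
From mathcomp Require Import all_boot all_order all_algebra.
From mathcomp Require Import all_classical all_reals all_analysis.
From mathcomp Require Import complex ring lra.

Set Implicit Arguments.
Unset Strict Implicit.
Unset Printing Implicit Defensive.

Import Order.TTheory GRing.Theory Num.Theory.
Import numFieldNormedType.Exports.

Local Open Scope classical_set_scope.
Local Open Scope ring_scope.

(** The bound is a comparison principle.  Let [d] be the sup norm of
    [xi - xi'], and let [x] and [y] be the points, to the right of the drivers
    [xi] and [xi'], that are absorbed at the same time [t].  If [y > x + d], then
    [y] starts farther from its driver than [x] does, so it is pulled left more
    slowly and their distance never drops below [y - x]
    ([flow_comparison]).  Up to time [t] the point [x] stays to the right of
    [xi], hence [y] stays at distance at least [y - x - d] from [xi'] and cannot
    be absorbed at time [t] ([hits_le]).  Exchanging the drivers bounds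
    [|x - y|], and reflection at the origin yields the statement for the points
    to the left of the drivers.  To pass from hitting times, which are infima,
    to solutions that do collide with the driver, one needs that a point is
    absorbed at only one time ([hits_unique]); this is uniqueness of solutions,
    which is again the comparison principle.

    The constant is sharp because translating a driver by a constant translates
    its inverse hitting times by the same constant.  The constant drivers 0 and
    1 suffice.  The driver [c] generates the vertical slit above [c]: its flow is
    [c + sqrt ((z - c)^2 - 4 t)], with the square root taken in the upper half
    plane, its curve at time [t] is at height [2 sqrt t], and its inverse
    hitting times are [c + 2 sqrt t] and [c - 2 sqrt t]
    ([simple_curve_driver_cst], [tau_plus_inverse_cst],
    [tau_minus_inverse_cst]). *)

(** * Derivatives relative to a set of times *)

Lemma difference_quotient_is_derive (R : realType) (u : R -> R) (s l : R) :
  (u r - u s) / (r - s) @[r --> s^'] --> l <-> is_derive s 1 u l.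
Proof.
have E : (u r - u s) / (r - s) @[r --> s^'] =
         h^-1 *: ((u \o shift s) (h *: (1 : R)) - u s) @[h --> 0^'].
  rewrite funeqE => P.
  change ((\forall r \near s, r != s -> P ((u r - u s) / (r - s))) =
   (\forall h \near (0 : R), h != 0 ->
      P (h^-1 *: ((u \o shift s) (h *: (1 : R)) - u s)))).
  rewrite (near_shift 0 s); congr (nbhs _ _); apply/funext => h /=.
  rewrite subr0 addrK -subr_eq0 addrK; apply/propext.
  by rewrite /GRing.scale /= mulr1 mulrC.
rewrite E; split=> [H|[H <-]].
  by apply: DeriveDef; [apply/cvg_ex; exists l|apply: cvg_lim].
exact: H.
Qed.

Lemma real_deriv_within_is_derive (R : realType) (A : set R) (u : R -> R) (s l : R) :
  (\forall r \near s, A r) ->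
  real_deriv_within A u s l -> is_derive s 1 u l.
Proof.
move=> As H; apply/difference_quotient_is_derive; apply: cvg_trans H => P HP.
change (\forall r \near s, r != s -> P ((u r - u s) / (r - s))).
have {}HP : \forall r \near s, r != s -> A r -> P ((u r - u s) / (r - s)) := HP.
by near=> r => rs; apply: (near HP r) => //; near: r.
Unshelve. all: by end_near.
Qed.

Lemma is_derive_real_deriv_within (R : realType) (A : set R) (u : R -> R)
    (s l : R) :
  is_derive s 1 u l -> real_deriv_within A u s l.
Proof.
move/difference_quotient_is_derive; apply: cvg_trans.
by apply: cvg_app; exact: cvg_within.
Qed.

Lemma real_deriv_within_cvg (R : realType) (A : set R) (u : R -> R) (s l : R) :
  real_deriv_within A u s l -> u @ within A (nbhs s) --> u s.
Proof.
move=> H.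
have D : (r - s) @[r --> within A s^'] --> 0.
  rewrite -(subrr s); apply: cvgB; last exact: cvg_cst.
  by move=> P Ps; do 2 (apply: cvg_within).
have C : ((u r - u s) / (r - s)) * (r - s) @[r --> within A s^'] --> 0.
  by rewrite -(mulr0 l); exact: cvgM.
apply/cvgrPdist_lt => e e0.
have {}C : \forall r \near s, r != s -> A r ->
    `|0 - (u r - u s) / (r - s) * (r - s)| < e.
  by move/cvgrPdist_lt: C => /(_ _ e0).
change (\forall r \near s, A r -> `|u s - u r| < e).
near=> r => Ar; have [->|rs] := eqVneq r s; first by rewrite subrr normr0.
have := near C r; rewrite divfK ?subr_eq0// sub0r opprB; exact.
Unshelve. all: by end_near.
Qed.

(** * Comparison of real Loewner flows *)

Lemma continuous_itvW (R : realType) (f : R -> R) (s t : R) :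
  s <= t -> {within `[0, t], continuous f} -> {within `[0, s], continuous f}.
Proof.
move=> st; apply: continuous_subspaceW => q /=.
by rewrite !in_itv /= => /andP[-> qs]; exact: le_trans st.
Qed.

Lemma real_solution_continuous (R : realType) (xi u : R -> R) (x t s : R) :
  real_solution xi x t u -> s < t -> {within `[0, s], continuous u}.
Proof.
move=> [_ Hu] st; apply/subspace_continuousP => r /=.
rewrite in_itv /= => /andP[r0 rs].
have rt : 0 <= r < t by rewrite r0 (le_lt_trans rs).
have [_ /real_deriv_within_cvg] := Hu r rt.
apply: cvg_trans; apply: cvg_app.
apply: within_subset => // q /=; rewrite !in_itv /= => /andP[-> qs] /=.
exact: le_lt_trans st.
Qed.

Lemma real_solution_is_derive (R : realType) (xi u : R -> R) (x t s : R) :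
  real_solution xi x t u -> 0 < s < t -> is_derive s 1 u (- 2 / (u s - xi s)).
Proof.
move=> [_ Hu] /andP[s0 st].
have [|_] := Hu s; first by rewrite ltW.
apply: real_deriv_within_is_derive.
have : s \in `]0, t[ by rewrite in_itv /= s0.
move/near_in_itvoo; apply: filterS => r; rewrite /= !in_itv /=.
by move=> /andP[/ltW r0 rt]; rewrite r0 rt.
Qed.

(** A solution may collide with the driver only at the open end of its life
    span, so up to any earlier time it keeps its sign relative to the driver
    and compactness bounds its distance from the driver below.  This makes the
    right-hand side of the equation Lipschitz there. *)
Lemma real_solution_gap (R : realType) (xi u : R -> R) (x t s : R) :
  {within `[0, s], continuous xi} -> xi 0 < x -> 0 <= s < t ->
  real_solution xi x t u ->
  exists2 m, 0 < m & forall r, 0 <= r <= s -> m <= u r - xi r.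
Proof.
move=> cxi x0 /andP[s0 st] Hu.
have cu := real_solution_continuous Hu st.
have cd : {within `[0, s], continuous (fun r => u r - xi r)}.
  by move=> r; apply: cvgB; [exact: cu|exact: cxi].
have [c cs minc] := EVT_min s0 cd.
exists (u c - xi c); last by move=> r rs; apply: minc; rewrite in_itv.
move: cs; rewrite in_itv /= => /andP[c0 cs].
rewrite ltNge; apply/negP => le0.
have cd' : {within `[0, c], continuous (fun r => u r - xi r)}.
  exact: continuous_itvW cs cd.
have [|q] := @IVT _ _ _ _ 0 c0 cd'.
  have u0 : 0 <= u 0 - xi 0 by rewrite Hu.1 subr_ge0 ltW.
  by rewrite le_max u0 ge_min le0 orbT.
rewrite in_itv /= => /andP[q0 qc] /eqP; rewrite subr_eq0 => /eqP.
by apply: (Hu.2 q _).1; rewrite q0 (le_lt_trans qc)// (le_lt_trans cs).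
Qed.

(** One-sided Gronwall inequality, where the differential inequality is only
    needed while [e] is negative.  If [e] became negative, the weighted function
    [e r * exp (- K r)] would have a negative minimum at some [c > 0]; but the
    inequality makes its derivative at [c] positive, so it is smaller just
    before [c]. *)
Lemma nonneg_of_derive_gt (R : realType) (e : R -> R) (K s : R) :
  {within `[0, s], continuous e} -> 0 <= e 0 ->
  (forall r, 0 < r <= s -> e r < 0 ->
     exists2 l, is_derive r 1 e l & K * e r < l) ->
  forall r, 0 <= r <= s -> 0 <= e r.
Proof.
move=> ce e0 He r /andP[r0 rs].
pose g q := e q * expR (- K * q).
have cg : {within `[0, s], continuous g}.
  move=> q; apply: cvgM; first exact: ce.
  apply: continuous_subspaceT => {}q.
  apply: (@continuous_comp _ _ _ (fun q => - K * q) expR).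
    by apply: cvgM; [exact: cvg_cst|exact: cvg_id].
  exact: continuous_expR.
have [c cs minc] := EVT_min (le_trans r0 rs) cg.
rewrite leNgt; apply/negP => er.
have gc : g c < 0.
  have rin : r \in `[0, s] by rewrite in_itv /= r0.
  by apply: le_lt_trans (minc r rin) _; rewrite /g pmulr_llt0 ?expR_gt0.
have ec : e c < 0 by move: gc; rewrite /g pmulr_llt0 ?expR_gt0.
move: cs; rewrite in_itv /= => /andP[c0 cs].
have {}c0 : 0 < c.
  by rewrite lt_neqAle c0 andbT; apply: contraTneq ec => <-; rewrite -leNgt.
have [|l de Kl] := He c _ ec; first by rewrite c0.
have dg : is_derive c 1 g (expR (- K * c) * (l - K * e c)).
  have dE : is_derive c 1 (fun q : R => expR (- K * q)) (- K * expR (- K * c)).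
    have dK : is_derive c 1 (fun q : R => - K * q) (- K).
      by apply: is_derive_eq; rewrite /GRing.scale /= mulr1.
    by rewrite [_ * expR _]mulrC; exact: is_derive1_comp.
  have -> : g = e * (fun q : R => expR (- K * q)) by [].
  apply: is_derive_eq; rewrite /GRing.scale /=; ring.
have pos : 0 < expR (- K * c) * (l - K * e c).
  by rewrite mulr_gt0 ?expR_gt0// subr_gt0.
move/difference_quotient_is_derive: dg => /cvgr_gt /(_ _ pos) dg.
have {}dg : \forall q \near c^'-, q != c -> 0 < (g q - g c) / (q - c).
  by apply: cvg_within; exact: dg.
have : \forall q \near c^'-, False.
  near=> q.
  have qc : q < c by near: q; exact: nbhs_left_lt.
  have : 0 < (g q - g c) / (q - c).
    by have := near dg q; apply; rewrite ?lt_eqF.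
  rewrite nmulr_lgt0 ?invr_lt0 ?subr_lt0// ltNge => /negP; apply.
  have q0 : 0 < q by near: q; exact: nbhs_left_gt.
  by apply: minc; rewrite in_itv /= (le_trans (ltW qc) cs) ltW.
by move/filter_ex => [].
Unshelve. all: by end_near.
Qed.

(** While the two points are at least [y - x] apart, the point started at [y]
    is at least as far from its driver as the one started at [x], hence it moves
    left no faster, and the distance cannot drop below [y - x].  That the
    distance does not cross this value at all is a Gronwall argument: with [a]
    and [b] the distances of the two points from their drivers, the difference
    of the velocities is [2 (b - a) / (a b)], and [b - a] is at least the excess
    [e] of the distance over [y - x].  With [x = y] and equal drivers, applied in both orders, this
    is uniqueness of solutions. *)
Lemma flow_comparison (R : realType) (xi xi' u v : R -> R) (x y t : R) :
  {within `[0, t], continuous xi} -> {within `[0, t], continuous xi'} ->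
  xi 0 < x -> xi' 0 < y ->
  real_solution xi x t u -> real_solution xi' y t v ->
  (forall r, 0 <= r < t -> xi' r - xi r <= y - x) ->
  forall r, 0 <= r < t -> y - x <= v r - u r.
Proof.
move=> cxi cxi' x0 y0 Hu Hv dxi s /andP[s0 st].
have s0t : 0 <= s < t by rewrite s0.
have [m m0 gu] := real_solution_gap (continuous_itvW (ltW st) cxi) x0 s0t Hu.
have [n n0 gv] := real_solution_gap (continuous_itvW (ltW st) cxi') y0 s0t Hv.
pose e r := v r - u r - (y - x).
suff : 0 <= e s by rewrite subr_ge0.
(* When [e < 0] the velocity difference is at least [2 e / (m n)]; the factor 3
   makes the inequality required by the Gronwall lemma strict. *)
apply: (@nonneg_of_derive_gt _ e (3 / (m * n)) s); last by rewrite s0 lexx.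
- move=> r; apply: cvgB; last exact: cvg_cst.
  by apply: cvgB; [exact: (real_solution_continuous Hv st)
                  |exact: (real_solution_continuous Hu st)].
- by rewrite /e Hu.1 Hv.1 subrr.
move=> r /andP[r0 rs] er.
have rt : 0 < r < t by rewrite r0 (le_lt_trans rs).
have du := real_solution_is_derive Hu rt.
have dv := real_solution_is_derive Hv rt.
exists (- 2 / (v r - xi' r) - - 2 / (u r - xi r)).
  have -> : e = v - u - cst (y - x) by [].
  by apply: is_derive_eq; rewrite subr0.
have rs' : 0 <= r <= s by rewrite ltW.
have {gu} a := gu r rs'; have {gv} b := gv r rs'.
have ba : e r <= (v r - xi' r) - (u r - xi r).
  rewrite /e; have : xi' r - xi r <= y - x by apply: dxi; case/andP: rt => /ltW-> ->.
  lra.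
move: (u r - xi r) (v r - xi' r) (e r) a b ba er => a b E ma nb EE E0.
have a0 : 0 < a by exact: lt_le_trans ma.
have b0 : 0 < b by exact: lt_le_trans nb.
apply: (@lt_le_trans _ _ (2 * E / (m * n))).
  by rewrite mulrAC ltr_pM2r ?invr_gt0 ?mulr_gt0//; lra.
apply: (@le_trans _ _ (2 * E / (a * b))).
  rewrite ler_nM2l; last lra.
  by rewrite lef_pV2 ?posrE ?mulr_gt0// ler_pM// ltW.
have -> : - 2 / b - - 2 / a = 2 * (b - a) / (a * b).
  by field; rewrite !gt_eqF.
by rewrite ler_pM2r ?invr_gt0 ?mulr_gt0// ler_pM2l.
Qed.

(** * Hitting times *)

(** Membership in the set whose infimum is the hitting time, for the horizon
    [+oo]. *)
Definition hits (R : realType) (xi : R -> R) (x t : R) : Prop :=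
  0 < t /\ exists2 u : R -> R, real_solution xi x t u &
    limf_einf (fun s : R => `|u s - xi s|%:E) (t^'-) = 0%E.

Lemma limf_einf_left_ge (R : realType) (f : R -> R) (a t m : R) :
  a < t -> (forall r, a < r < t -> m <= f r) ->
  (m%:E <= limf_einf (fun s => (f s)%:E) t^'-)%E.
Proof.
move=> at_ fm; rewrite limf_einfE.
apply: (@le_trans _ _ (ereal_inf ((fun s => (f s)%:E) @` `]a, t[))).
  apply: le_ereal_inf_tmp => e [r /=]; rewrite in_itv /= => rat <-{e}.
  by rewrite lee_fin fm.
apply: ereal_sup_ubound; exists [set` `]a, t[] => //.
near=> r; rewrite /= in_itv /=; apply/andP; split.
  by near: r; exact: nbhs_left_gt.
by near: r; exact: nbhs_left_lt.
Unshelve. all: by end_near.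
Qed.

Lemma limf_einf_left_eq0 (R : realType) (f : R -> R) (t : R) :
  (forall r, 0 <= f r) -> f r @[r --> t^'-] --> 0 ->
  limf_einf (fun s => (f s)%:E) t^'- = 0%E.
Proof.
move=> f0 ft; apply/eqP; rewrite eq_le; apply/andP; split; last first.
  by apply: (@limf_einf_left_ge _ _ (t - 1)) => // ; rewrite ltrBlDr ltrDl.
rewrite limf_einfE; apply: ge_ereal_sup => b [V HV <-{b}].
apply/lee_addgt0Pr => e e0; rewrite add0e.
have : \forall r \near t^'-, V r /\ f r <= e.
  near=> r; split; first by near: r.
  have : `|0 - f r| < e by near: r; move/cvgrPdist_lt: ft => /(_ _ e0).
  by rewrite sub0r normrN ger0_norm// => /ltW.
move/filter_ex => [r [Vr fr]].
apply: (@le_trans _ _ (f r)%:E); last by rewrite lee_fin.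
by apply: ereal_inf_lbound; exists r.
Unshelve. all: by end_near.
Qed.

(** If the point were absorbed at both [s] and a later time [t], the solution
    living until [t] would coincide before [s] with the one absorbed at [s],
    although it stays away from the driver up to [s]. *)
Lemma hits_minimal (R : realType) (xi : R -> R) (x s t : R) :
  {within `[0, t], continuous xi} -> xi 0 < x ->
  hits xi x s -> hits xi x t -> t <= s.
Proof.
move=> cxi x0 [s0 [u Hu lu]] [t0 [v Hv _]]; rewrite leNgt; apply/negP => st.
have cxis := continuous_itvW (ltW st) cxi.
have Hvs : real_solution xi x s v.
  split; first exact: Hv.1.
  move=> r /andP[r0 rs]; have [|A B] := Hv.2 r; first by rewrite r0 (lt_trans rs).
  split=> //; apply: cvg_trans B; apply: cvg_app.
  apply: within_subset => q /=; rewrite !in_itv /= => /andP[-> qs] /=.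
  exact: lt_trans st.
have s0t : 0 <= s < t by rewrite ltW.
have [m m0 gv] := real_solution_gap cxis x0 s0t Hv.
have : (m%:E <= limf_einf (fun r => `|u r - xi r|%:E) s^'-)%E.
  apply: (@limf_einf_left_ge _ _ 0) => // r /andP[r0 rs].
  apply: le_trans (ler_norm _).
  have rr : 0 <= r < s by rewrite ltW.
  have := flow_comparison cxis cxis x0 x0 Hvs Hu _ rr; rewrite subrr => H.
  have : 0 <= u r - v r by apply: H => q _; rewrite subrr.
  by have := gv r; rewrite (ltW r0) (ltW rs) => /(_ isT); lra.
by rewrite lu lee_fin leNgt m0.
Qed.

Lemma hits_unique (R : realType) (xi : R -> R) (x s t : R) :
  {within `[0, s], continuous xi} -> {within `[0, t], continuous xi} ->
  xi 0 < x -> hits xi x s -> hits xi x t -> s = t.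
Proof.
move=> cs ct x0 Hs Ht; apply/eqP; rewrite eq_le.
by rewrite (hits_minimal cs x0 Ht Hs) (hits_minimal ct x0 Hs Ht).
Qed.

Definition continuous_driver (R : realType) (T : \bar R) (xi : R -> R) : Prop :=
  forall r : R, (r%:E <= T)%E -> {within `[0, r], continuous xi}.

(** The infimum defining the hitting time runs over at most one element, so a
    finite hitting time is attained. *)
Lemma hitting_time_hits (R : realType) (T : \bar R) (xi : R -> R) (x t : R) :
  continuous_driver T xi -> xi 0 < x ->
  hitting_time T xi x = t%:E <-> hits xi x t /\ (t%:E <= T)%E.
Proof.
move=> cxi x0; rewrite /hitting_time gt_eqF//.
set A := (X in ereal_inf X).
have AE s : hits xi x s -> (s%:E <= T)%E -> A = [set s%:E].
  move=> hs sT; apply/seteqP; split=> [_ [r [r0 rT Hr] <-]|_ ->].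
    by congr EFin; apply: (hits_unique (cxi _ rT) (cxi _ sT) x0 _ hs).
  by exists s => //; case: hs.
split=> [At|[ht tT]]; last by rewrite (AE t)// ereal_inf1.
have [s [hs sT]] : exists s, hits xi x s /\ (s%:E <= T)%E.
  have /set0P[_ [s [s0 sT Hs] _]] : A != set0.
    by apply: contra_eq_neq At => ->; rewrite ereal_inf0.
  by exists s.
by move: At; rewrite (AE s)// ereal_inf1 => -[<-].
Qed.

(** * The Lipschitz bound *)

Lemma tau_plus_inverse_hits (R : realType) (T : \bar R) (xi f : R -> R)
    (t : R) :
  continuous_driver T xi ->
  tau_plus_inverse T xi f -> time_set T t ->
  (t = 0 /\ f t = xi 0) \/ (xi 0 < f t /\ hits xi (f t) t).
Proof.
move=> cxi Hf Ht; have [/= Df Hft _] := Hf t Ht.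
have [E|ne] := eqVneq (f t) (xi 0).
  by left; move: Hft; rewrite /hitting_time E eqxx => -[<-].
have lt : xi 0 < f t by rewrite lt_neqAle eq_sym ne.
by right; split => //; case/(hitting_time_hits _ cxi lt): Hft.
Qed.

(** If [y - x > d], the points stay at least [y - x] apart while the drivers
    are at most [d] apart; since [x] stays to the right of its driver, [y] stays
    at distance at least [y - x - d] from its own and is not absorbed at
    time [t]. *)
Lemma hits_le (R : realType) (xi xi' : R -> R) (x y t d : R) :
  {within `[0, t], continuous xi} -> {within `[0, t], continuous xi'} ->
  xi 0 < x -> xi' 0 < y -> hits xi x t -> hits xi' y t ->
  (forall r, 0 <= r <= t -> xi' r - xi r <= d) -> y - x <= d.
Proof.
move=> cxi cxi' x0 y0 [t0 [u Hu _]] [_ [v Hv lv]] dxi.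
rewrite leNgt; apply/negP => lt.
have dxi' r : 0 <= r < t -> xi' r - xi r <= d.
  by move=> /andP[r0 rt]; apply: dxi; rewrite r0 ltW.
have vu : forall r, 0 <= r < t -> y - x <= v r - u r.
  apply: (flow_comparison cxi cxi') => // r rt.
  by apply: le_trans (dxi' _ rt) (ltW lt).
have : ((y - x - d)%:E <= limf_einf (fun r => `|v r - xi' r|%:E) t^'-)%E.
  apply: (@limf_einf_left_ge _ _ 0) => // r /andP[r0 rt].
  apply: le_trans (ler_norm _).
  have rr : 0 <= r < t by rewrite ltW.
  have [m m0 gu] : exists2 m, 0 < m & forall q, 0 <= q <= r -> m <= u q - xi q.
    by apply: real_solution_gap Hu => //; exact: continuous_itvW (ltW rt) cxi.
  have := gu r; rewrite (ltW r0) lexx => /(_ isT).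
  have := vu _ rr; have := dxi' _ rr; lra.
by rewrite lv lee_fin; lra.
Qed.

Lemma sup_norm_ge (R : realType) (T : \bar R) (f : R -> R) (t : R) :
  time_set T t -> (`|f t|%:E <= sup_norm T f)%E.
Proof. by move=> Ht; apply: ereal_sup_ubound; exists t. Qed.

Lemma tau_plus_inverse_sub_le (R : realType) (T : \bar R)
    (xi xi' f f' : R -> R) (t d : R) :
  continuous_driver T xi -> continuous_driver T xi' ->
  tau_plus_inverse T xi f -> tau_plus_inverse T xi' f' ->
  (forall r, time_set T r -> `|xi r - xi' r| <= d) ->
  time_set T t -> f' t - f t <= d.
Proof.
move=> cxi cxi' Hf Hf' dxi Ht.
have [t0 tT] := andP Ht.
have dxi' r : 0 <= r <= t -> xi' r - xi r <= d.
  move=> /andP[r0 rt]; apply: le_trans (ler_norm _) _; rewrite distrC.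
  by apply: dxi; rewrite /time_set /= r0 (le_trans _ tT)// lee_fin.
have [[E ->]|[x0 hx]] := tau_plus_inverse_hits cxi Hf Ht;
  have [[E' ->]|[y0 hy]] := tau_plus_inverse_hits cxi' Hf' Ht.
- by apply: dxi'; rewrite lexx.
- by case: hy; rewrite E ltxx.
- by case: hx; rewrite E' ltxx.
- exact: (hits_le (cxi _ tT) (cxi' _ tT) x0 y0 hx hy dxi').
Qed.

Lemma tau_plus_inverse_lipschitz (R : realType) (T : \bar R)
    (xi xi' f f' : R -> R) :
  continuous_driver T xi -> continuous_driver T xi' ->
  tau_plus_inverse T xi f -> tau_plus_inverse T xi' f' ->
  (sup_norm T (fun t => f t - f' t)%R <=
   sup_norm T (fun t => xi t - xi' t)%R)%E.
Proof.
move=> cxi cxi' Hf Hf'; apply: ge_ereal_sup => b [t Ht <-{b}].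
case E : (sup_norm T (fun t => xi t - xi' t)) => [d| |].
- have dxi r : time_set T r -> `|xi r - xi' r| <= d.
    by move=> Hr; rewrite -lee_fin -E; exact: (sup_norm_ge (fun t => xi t - xi' t)).
  have dxi' r : time_set T r -> `|xi' r - xi r| <= d.
    by move=> Hr; rewrite distrC dxi.
  rewrite lee_fin ler_norml; apply/andP; split.
    by rewrite lerNl opprB (tau_plus_inverse_sub_le cxi cxi' Hf Hf' dxi).
  exact: (tau_plus_inverse_sub_le cxi' cxi Hf' Hf dxi').
- by rewrite leey.
- by have := sup_norm_ge (fun t => xi t - xi' t) Ht; rewrite E.
Qed.

(** The equation is invariant under reflection at the origin, which exchanges
    the two inverse hitting times. *)
Lemma real_solution_opp (R : realType) (xi u : R -> R) (x t : R) :
  real_solution xi x t u -> real_solution (\- xi) (- x) t (\- u).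
Proof.
move=> [u0 Hu]; split; first by rewrite /= u0.
move=> s st; have [ne D] := Hu s st; split=> [/oppr_inj//|].
have -> : - 2 / ((\- u) s - (\- xi) s) = - (- 2 / (u s - xi s)).
  by rewrite -opprD invrN mulrN.
rewrite /real_deriv_within.
under eq_fun do rewrite -opprD mulNr.
exact: cvgN.
Qed.

Lemma hits_opp (R : realType) (xi : R -> R) (x t : R) :
  hits xi x t -> hits (\- xi) (- x) t.
Proof.
move=> [t0 [u Hu lu]]; split => //; exists (\- u).
  exact: real_solution_opp.
by rewrite -lu; congr limf_einf; apply/funext => s; rewrite -opprD normrN.
Qed.

Lemma hitting_time_opp (R : realType) (T : \bar R) (xi : R -> R) (x : R) :
  hitting_time T (\- xi) (- x) = hitting_time T xi x.
Proof.
rewrite /hitting_time /= eqr_opp; case: ifP => // _.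
congr (ereal_inf (image _ _)); apply/funext => t; apply/propext.
split=> -[t0 tT Ht]; split=> //.
  have [_] := hits_opp (conj t0 Ht).
  by rewrite opprK; have -> : \- (\- xi) = xi by apply/funext => r /=; rewrite opprK.
by have [_] := hits_opp (conj t0 Ht).
Qed.

Lemma tau_minus_inverse_opp (R : realType) (T : \bar R) (xi f : R -> R) :
  tau_minus_inverse T xi f <-> tau_plus_inverse T (\- xi) (\- f).
Proof.
split=> H t Ht; have [/= D E U] := H t Ht; split=> /=.
- by rewrite lerN2.
- by rewrite hitting_time_opp.
- move=> x Dx Hx; rewrite -(U (- x)) ?opprK//; first by rewrite lerNl.
  by rewrite -hitting_time_opp opprK.
- by rewrite -lerN2.
- by rewrite -hitting_time_opp.
- move=> x Dx Hx; apply: oppr_inj; rewrite -(U (- x))// ?lerN2//.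
  by rewrite hitting_time_opp.
Qed.

Lemma tau_minus_inverse_lipschitz (R : realType) (T : \bar R)
    (xi xi' f f' : R -> R) :
  continuous_driver T xi -> continuous_driver T xi' ->
  tau_minus_inverse T xi f -> tau_minus_inverse T xi' f' ->
  (sup_norm T (fun t => f t - f' t)%R <=
   sup_norm T (fun t => xi t - xi' t)%R)%E.
Proof.
move=> cxi cxi' /tau_minus_inverse_opp Hf /tau_minus_inverse_opp Hf'.
have copp (g : R -> R) : continuous_driver T g -> continuous_driver T (\- g).
  by move=> cg r rT x; apply: cvgN; exact: cg.
have := tau_plus_inverse_lipschitz (copp _ cxi) (copp _ cxi') Hf Hf'.
have E (a b : R -> R) : sup_norm T (fun t => (\- a) t - (\- b) t) =
    sup_norm T (fun t => a t - b t).
  congr (ereal_sup (image _ _)); apply/funext => t.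
  by rewrite -opprD normrN.
by rewrite !E.
Qed.

Lemma simple_curve_driver_continuous (R : realType) (T : \bar R) (xi : R -> R) :
  (0 < T)%E -> simple_curve_driver T xi ->
  continuous_driver T xi.
Proof.
case: T => [T| |] //=.
  move=> _ [cxi _] r; rewrite lee_fin => rT; exact: continuous_itvW rT cxi.
move=> _ H r _; have [|cxi _] := H (Num.max r 1); first by rewrite lt_max ltr01 orbT.
by apply: continuous_itvW cxi; rewrite le_max lexx.
Qed.

(** * The square root with values in the closed upper half plane *)

Definition upper_sqrt (R : realType) (w : Cplx R) : Cplx R :=
  let s := sqrtc w in if 0 <= complex.Im s then s else - s.

Lemma upper_sqrtK (R : realType) (w : Cplx R) : upper_sqrt w ^+ 2 = w.
Proof.
by rewrite /upper_sqrt; case: ifP => _; rewrite ?sqrrN; exact: sqr_sqrtc.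
Qed.

Lemma Im_upper_sqrt_ge0 (R : realType) (w : Cplx R) :
  0 <= complex.Im (upper_sqrt w).
Proof.
rewrite /upper_sqrt; case: ifPn => //; rewrite -ltNge => /ltW.
by case: (sqrtc w) => a b /=; rewrite oppr_ge0.
Qed.

Lemma upper_sqrt_unique (R : realType) (z w : Cplx R) :
  0 < complex.Im z -> z ^+ 2 = w -> upper_sqrt w = z.
Proof.
move=> z0 zw; have := upper_sqrtK w; rewrite -{2}zw => /eqP.
rewrite eqf_sqr => /orP[/eqP //|/eqP E].
have := Im_upper_sqrt_ge0 w; rewrite E.
by case: z z0 {E zw} => a b /= b0; rewrite oppr_ge0 leNgt b0.
Qed.

(** A point of the upper half plane with real square lies on the imaginary
    axis.  This determines the range of the flow below: its slit is the set of
    points where the inverse square root fails to stay in the half plane. *)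
Lemma sqr_real_upper (R : realType) (z : Cplx R) (r : R) :
  0 < complex.Im z -> z ^+ 2 = r%:C%C ->
  z = (0 +i* complex.Im z)%C /\ r = - complex.Im z ^+ 2.
Proof.
case: z => a b /= b0 [E1 E2].
have a0 : a = 0.
  have /eqP : a * b = 0 by lra.
  by rewrite mulf_eq0 (gt_eqF b0) orbF => /eqP.
by split; [rewrite a0|rewrite -E1 a0; ring].
Qed.

Lemma Im_upper_sqrt_gt0 (R : realType) (w : Cplx R) :
  (forall r : R, w != (r ^+ 2)%:C%C) -> 0 < complex.Im (upper_sqrt w).
Proof.
move=> wr; rewrite lt_neqAle Im_upper_sqrt_ge0 andbT; apply/negP => /eqP E.
have := wr (complex.Re (upper_sqrt w)); rewrite -{1}(upper_sqrtK w).
case: (upper_sqrt w) E => a b /= <-; apply/negP; rewrite negbK.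
by apply/eqP; congr Complex; ring.
Qed.

Lemma Im_upper_sqrt_flow_gt0 (R : realType) (z : Cplx R) (t : R) :
  0 < complex.Im z -> 0 <= t ->
  0 < complex.Im (upper_sqrt (z ^+ 2 - (4 * t)%:C%C)).
Proof.
move=> z0 t0; apply: Im_upper_sqrt_gt0 => r; apply/eqP => /eqP.
rewrite subr_eq -rmorphD /= => /eqP /(sqr_real_upper z0)[_ E].
have := sqr_ge0 r; have := exprn_gt0 2 z0; lra.
Qed.

Lemma Im_le_norm (R : realType) (z : Cplx R) : (complex.Im z)%:C%C <= `|z|.
Proof.
rewrite [`|z|]normc_def lecR; apply: le_trans (ler_norm _) _.
by rewrite -sqrtr_sqr ler_wsqrtr// lerDr sqr_ge0.
Qed.

(** Stated over an abstract field because the topology of [Cplx R] is that of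
    its structure of normed field. *)
Lemma cvg_of_lipschitz (C : numFieldType) (S : C -> C) (w k : C) :
  0 < k -> (forall v, `|S w - S v| * k <= `|w - v|) -> S @ w --> S w.
Proof.
move=> k0 H; have Fw := nbhs_filter w.
have near_lt (e : C) : 0 < e -> \forall v \near w, `|w - v| < e.
  by move=> e0; apply/nbhs_ballP; exists e.
suff D (e : C) : 0 < e -> \forall v \near w, `|S w - S v| < e.
  by apply/cvgrPdist_lt => e; exact: D.
move=> e0; apply: filterS (near_lt _ (mulr_gt0 e0 k0)) => v wv.
by rewrite -(ltr_pM2r k0); exact: le_lt_trans (H v) wv.
Qed.

(** [|S w - S v|] equals [|w - v| / |S w + S v|], and the denominator is at
    least the imaginary part of [S w] because that of [S v] is nonnegative. *)
Lemma upper_sqrt_continuous (R : realType) (w : Cplx R) :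
  0 < complex.Im (upper_sqrt w) -> @upper_sqrt R @ w --> upper_sqrt w.
Proof.
move=> S0.
apply: (@cvg_of_lipschitz _ _ _ (complex.Im (upper_sqrt w))%:C%C) => [|v].
  by rewrite ltcR.
rewrite -{3}(upper_sqrtK w) -{2}(upper_sqrtK v) subr_sqr normrM.
rewrite ler_wpM2l// ?normr_ge0//; apply: le_trans (Im_le_norm _).
rewrite lecR; have := Im_upper_sqrt_ge0 v.
by case: (upper_sqrt w) => a b; case: (upper_sqrt v) => c d /= d0; rewrite lerDl.
Qed.

(** The type ascription makes the image carry the topology of [Cplx R]. *)
Definition cplx_of_real (R : realType) (x : R) : Cplx R := x%:C%C.

Lemma cplx_of_real_continuous (R : realType) : continuous (@cplx_of_real R).
Proof.
move=> x; apply/cvgrPdist_lt => -[e e'].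
rewrite ltcE /= => /andP[/eqP -> e0].
have /cvgrPdist_lt /(_ _ e0) xy' : y @[y --> x] --> x by exact: cvg_id.
near=> y; rewrite /cplx_of_real -rmorphB /= [`|_|]normc_def /= expr0n addr0 sqrtr_sqr.
have xy : `|x - y| < e by near: y.
by rewrite -[(e +i* 0)%C]/(e%:C%C) ltcR.
Unshelve. all: by end_near.
Qed.

(** * The flow of a constant driver *)

(** With constant driver [c] the equation says that [(h - c) ^+ 2] decreases at
    rate 4. *)
Definition slit_flow (R : realType) (c t : R) (z : Cplx R) : Cplx R :=
  cplx_of_real c + upper_sqrt ((z - cplx_of_real c) ^+ 2 - cplx_of_real (4 * t)).

Lemma Im_subC (R : realType) (c : R) (z : Cplx R) :
  complex.Im (z - cplx_of_real c) = complex.Im z.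
Proof. by case: z => a b /=; rewrite subr0. Qed.

Lemma Im_addC (R : realType) (c : R) (z : Cplx R) :
  complex.Im (cplx_of_real c + z) = complex.Im z.
Proof. by case: z => a b /=; rewrite add0r. Qed.

Lemma neq0_of_Im_gt0 (R : realType) (z : Cplx R) :
  0 < complex.Im z -> z != 0.
Proof. by apply: contraTneq => ->; rewrite /= ltxx. Qed.

Lemma upper_sqrt_sum_neq0 (R : realType) (v w : Cplx R) :
  0 < complex.Im (upper_sqrt w) -> upper_sqrt v + upper_sqrt w != 0.
Proof.
move=> w0; apply: neq0_of_Im_gt0; have := Im_upper_sqrt_ge0 v.
case: (upper_sqrt v) => a b; case: (upper_sqrt w) w0 => d e /= e0 b0.
by rewrite ltr_wpDl.
Qed.

(** Rationalizing the numerator turns the difference quotients of the flow in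
    time and in space into expressions that extend continuously to increment
    zero. *)
Lemma upper_sqrt_sub (R : realType) (v w : Cplx R) :
  0 < complex.Im (upper_sqrt w) ->
  upper_sqrt v - upper_sqrt w = (v - w) / (upper_sqrt v + upper_sqrt w).
Proof.
move=> w0; have n0 := upper_sqrt_sum_neq0 v w0.
by apply: (mulIf n0); rewrite divfK// -subr_sqr !upper_sqrtK.
Qed.

Lemma upward_flow_slit (R : realType) (c T : R) :
  upward_flow T (cst c) (slit_flow c).
Proof.
move=> z z0; have z0' : 0 < complex.Im (z - cplx_of_real c) by rewrite Im_subC.
split.
  by rewrite /slit_flow mulr0 subr0 (upper_sqrt_unique z0')// addrC subrK.
move=> t /andP[t0 tT]; pose w s := (z - cplx_of_real c) ^+ 2 - cplx_of_real (4 * s).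
have S0 : 0 < complex.Im (upper_sqrt (w t)) by exact: Im_upper_sqrt_flow_gt0.
have hE : slit_flow c t z - cplx_of_real c = upper_sqrt (w t).
  by rewrite /slit_flow addrC addKr.
split.
  by move/eqP; rewrite -subr_eq0 hE; apply/negP; exact: neq0_of_Im_gt0.
rewrite /= hE /cplx_deriv_within.
have -> : - 2 / upper_sqrt (w t) = - 4 / (upper_sqrt (w t) + upper_sqrt (w t)).
  have n0 := neq0_of_Im_gt0 S0.
  by field; rewrite n0 andbT; exact: upper_sqrt_sum_neq0.
have wt : w s @[s --> t] --> w t.
  have t4 : 4 * s @[s --> t] --> 4 * t.
    by apply: cvgM; [exact: cvg_cst|exact: cvg_id].
  exact: cvgB (cvg_cst _) (cvg_comp _ _ t4 (@cplx_of_real_continuous _ _)).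
have St : upper_sqrt (w s) @[s --> t] --> upper_sqrt (w t).
  exact: (cvg_comp _ _ wt (upper_sqrt_continuous S0)).
have L : - 4 / (upper_sqrt (w s) + upper_sqrt (w t)) @[s --> t] -->
    - 4 / (upper_sqrt (w t) + upper_sqrt (w t)).
  exact: cvgM (cvg_cst _) (cvgV (upper_sqrt_sum_neq0 _ S0)
    (cvgD St (cvg_cst _))).
apply: (@cvg_trans _ (- 4 / (upper_sqrt (w s) + upper_sqrt (w t))
    @[s --> within `[0, T] t^'])); last first.
  apply: cvg_trans L; apply: cvg_app.
  by move=> P HP; do 2 (apply: cvg_within).
apply: near_eq_cvg.
have : \forall s \near within `[0, T] t^', s != t.
  by apply: cvg_within; apply: nearW.
apply: filterS => s st.
have st0 : cplx_of_real (s - t) != 0 by rewrite (inj_eq (@complexI _)) subr_eq0.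
have -> : slit_flow c s z - slit_flow c t z =
    upper_sqrt (w s) - upper_sqrt (w t) by rewrite /slit_flow -/(w s) -/(w t); ring.
rewrite upper_sqrt_sub// /w.
have -> : (z - cplx_of_real c) ^+ 2 - cplx_of_real (4 * s) -
    ((z - cplx_of_real c) ^+ 2 - cplx_of_real (4 * t))
  = - 4 * cplx_of_real (s - t).
  by rewrite /cplx_of_real !rmorphM !rmorphB /= rmorph_nat; ring.
rewrite -/(w s) -/(w t) mulrAC mulfK//.
Qed.

Definition slit (R : realType) (c t : R) : Cplx R := (c +i* (2 * Num.sqrt t))%C.

Lemma slit_continuous (R : realType) (c : R) : continuous (slit c).
Proof.
move=> t.
pose g s : Cplx R := cplx_of_real c + 'i%C * cplx_of_real (2 * Num.sqrt s).
have -> : slit c = g.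
  by apply/funext => s; rewrite /g /slit; congr Complex => /=; ring.
have t2 : 2 * Num.sqrt s @[s --> t] --> 2 * Num.sqrt t.
  by apply: cvgM; [exact: cvg_cst|exact: sqrt_continuous].
exact: cvgD (cvg_cst _)
  (cvgM (cvg_cst _) (cvg_comp _ _ t2 (@cplx_of_real_continuous _ _))).
Qed.

(** The inverse of the flow is [w |-> c + sqrt ((w - c)^2 + 4 T)].  It
    leaves the open half plane exactly where [(w - c)^2 + 4 T] is a nonnegative
    real, that is on the vertical slit of height [2 sqrt T] above [c]. *)
Lemma slit_flow_bij (R : realType) (c T : R) : 0 <= T ->
  set_bij (@upper_half_plane R)
    (@upper_half_plane R `\` slit c @` `]0, T]) (slit_flow c T).
Proof.
move=> T0; split.
- move=> z z0; have z0' : 0 < complex.Im (z - cplx_of_real c) by rewrite Im_subC.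
  split; first by rewrite /upper_half_plane /= Im_addC Im_upper_sqrt_flow_gt0.
  move=> [s /=]; rewrite in_itv /= => /andP[s0 sT] E.
  have := upper_sqrtK ((z - cplx_of_real c) ^+ 2 - cplx_of_real (4 * T)).
  have -> : upper_sqrt ((z - cplx_of_real c) ^+ 2 - cplx_of_real (4 * T)) =
      slit c s - cplx_of_real c by rewrite E /slit_flow [RHS]addrC addKr.
  move/eqP; rewrite eq_sym subr_eq.
  have -> : (slit c s - cplx_of_real c) ^+ 2 = cplx_of_real (- 4 * s).
    rewrite /slit /cplx_of_real; congr Complex => /=; last by ring.
    have := sqr_sqrtr (ltW s0); rewrite expr2; lra.
  rewrite /cplx_of_real -rmorphD /= => /eqP /(sqr_real_upper z0')[_ H].
  have := exprn_gt0 2 z0'; lra.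
- move=> z z' /set_mem z0 /set_mem z0' /addrI E.
  have : z - cplx_of_real c = z' - cplx_of_real c.
    have zc : 0 < complex.Im (z - cplx_of_real c) by rewrite Im_subC.
    have zc' : 0 < complex.Im (z' - cplx_of_real c) by rewrite Im_subC.
    rewrite -(upper_sqrt_unique zc (erefl _)) -(upper_sqrt_unique zc' (erefl _)).
    congr upper_sqrt.
    have := congr1 (fun x => x ^+ 2) E; rewrite !upper_sqrtK.
    exact: addIr.
  exact: addIr.
- move=> w [w0 wslit].
  have w0' : 0 < complex.Im (w - cplx_of_real c) by rewrite Im_subC.
  pose v := (w - cplx_of_real c) ^+ 2 + cplx_of_real (4 * T).
  have Sv : 0 < complex.Im (upper_sqrt v).
    apply: Im_upper_sqrt_gt0 => r; apply/eqP => E.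
    have : (w - cplx_of_real c) ^+ 2 = (r ^+ 2 - 4 * T)%:C%C.
      by rewrite rmorphB /= -E /v addrK.
    case/(sqr_real_upper w0'); set b := complex.Im _ => wb bE.
    have b0 : 0 < b by [].
    (* Here [w] is [c + i b], a height that the slit reaches at time [(b / 2)^2],
       and this is at most [T] because [b^2 = 4 T - r^2]. *)
    apply: wslit; exists ((b / 2) ^+ 2).
      have := sqr_ge0 r; have := exprn_gt0 2 b0.
      by rewrite /= in_itv /= => ? ?; apply/andP; split; lra.
    rewrite /slit sqrtr_sqr ger0_norm; last by lra.
    apply: (addIr (- cplx_of_real c)); rewrite wb /cplx_of_real.
    by congr Complex => /=; lra.
  exists (cplx_of_real c + upper_sqrt v).
    by rewrite /upper_half_plane /= Im_addC.
  rewrite /slit_flow [_ + _ - _]addrC addKr upper_sqrtK /v addrK.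
  by rewrite (upper_sqrt_unique w0')// addrC subrK.
Qed.

Lemma slit_flow_derivable (R : realType) (c T : R) (z : Cplx R) :
  0 <= T -> upper_half_plane z -> derivable (slit_flow c T) z 1.
Proof.
move=> T0 z0; have z0' : 0 < complex.Im (z - cplx_of_real c) by rewrite Im_subC.
pose a := z - cplx_of_real c.
pose w h := (h + a) ^+ 2 - cplx_of_real (4 * T).
have w0E : w 0 = a ^+ 2 - cplx_of_real (4 * T) by rewrite /w add0r.
have S0 : 0 < complex.Im (upper_sqrt (w 0)).
  by rewrite w0E; exact: Im_upper_sqrt_flow_gt0.
have F0 := nbhs_filter (0 : Cplx R).
have wt : w h @[h --> (0 : Cplx R)] --> w 0.
  have ha : h + a @[h --> (0 : Cplx R)] --> 0 + a by exact: cvgD cvg_id (cvg_cst _).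
  exact: cvgB (cvgM ha ha) (cvg_cst _).
have St : upper_sqrt (w h) @[h --> (0 : Cplx R)] --> upper_sqrt (w 0).
  exact: (cvg_comp _ _ wt (upper_sqrt_continuous S0)).
pose q h := (h + (a + a)) / (upper_sqrt (w h) + upper_sqrt (w 0)).
have L : q h @[h --> (0 : Cplx R)] --> q 0.
  exact: cvgM (cvgD cvg_id (cvg_cst _)) (cvgV (upper_sqrt_sum_neq0 _ S0)
    (cvgD St (cvg_cst _))).
apply/cvg_ex; exists (q 0).
apply: (@cvg_trans _ (q h @[h --> (0 : Cplx R)^'])); last first.
  by apply: cvg_trans L; apply: cvg_app; exact: cvg_within.
apply: near_eq_cvg.
have : \forall h \near (0 : Cplx R)^', h != 0.
  exact: nbhs_dnbhs_neq.
apply: filterS => h h0; apply: (mulfI h0); rewrite /GRing.scale /= mulVKf//.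
have -> : slit_flow c T (h * 1 + z) - slit_flow c T z =
    upper_sqrt (w h) - upper_sqrt (w 0).
  have ha : h * 1 + z - cplx_of_real c = h + a by rewrite mulr1 -addrA.
  by rewrite w0E /w /slit_flow ha -/a; ring.
rewrite upper_sqrt_sub// /q mulrA; congr (_ / _).
by rewrite w0E /w; ring.
Qed.

Lemma simple_curve_driver_cst (R : realType) (T : \bar R) (c : R) :
  (0 < T)%E -> simple_curve_driver T (cst c).
Proof.
have fin (r : R) : 0 < r -> simple_curve_driver_fin r (cst c).
  move=> r0; split; first by move=> x; exact: cvg_cst.
  exists (slit_flow c), (slit c); split.
  - exact: upward_flow_slit.
  - split; first by apply: continuous_subspaceT; exact: slit_continuous.
    move=> s t /set_mem /=; rewrite in_itv /= => /andP[s0 _].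
    move=> /set_mem /=; rewrite in_itv /= => /andP[t0 _] [/mulfI E].
    by apply/eqP; rewrite -eqr_sqrt//; apply/eqP/E; rewrite pnatr_eq0.
  - by rewrite /slit sqrtr0 mulr0.
  - by move=> t /andP[t0 _]; rewrite /upper_half_plane /= mulr_gt0// sqrtr_gt0.
  - split; first by apply: slit_flow_bij; exact: ltW.
    by move=> z; apply: slit_flow_derivable; exact: ltW.
by case: T => [r| |] //=; rewrite lte_fin; exact: fin.
Qed.

(** * Hitting times of a constant driver *)

(** Under a constant driver [(u - c) ^+ 2] decreases at rate 4 and vanishes at
    time [(x - c) ^+ 2 / 4]. *)
Lemma hits_cst (R : realType) (c x : R) :
  c < x -> hits (cst c) x ((x - c) ^+ 2 / 4).
Proof.
move=> cx; have xc : 0 < x - c by rewrite subr_gt0.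
have x2 := exprn_gt0 2 xc.
have tau0 : 0 < (x - c) ^+ 2 / 4 by lra.
split => //.
pose v s := Num.sqrt ((x - c) ^+ 2 - 4 * s).
exists (fun s => c + v s).
  split; first by rewrite /v mulr0 subr0 sqrtr_sqr ger0_norm ?ltW// addrC subrK.
  move=> s /andP[s0 st]; have vs : 0 < (x - c) ^+ 2 - 4 * s by lra.
  have v0 : 0 < v s by rewrite sqrtr_gt0.
  split; first by apply/eqP; rewrite -subr_eq0 [_ + _ - _]addrC addKr gt_eqF.
  apply: is_derive_real_deriv_within.
  have d1 : is_derive s 1 (fun s : R => (x - c) ^+ 2 - 4 * s) (- 4).
    by apply: is_derive_eq; rewrite /GRing.scale /=; ring.
  have d2 : is_derive s 1 v ((2 * v s)^-1 * - 4).
    by apply: is_derive1_comp; exact: is_derive1_sqrt.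
  have -> : (fun s => c + v s) = cst c + v by [].
  apply: is_derive_eq; rewrite add0r /cst [_ + _ - _]addrC addKr.
  by field; rewrite gt_eqF.
under eq_fun do rewrite [_ + _ - _]addrC addKr.
apply: (@limf_einf_left_eq0 _ (fun s => `|v s|)) => [r|]; first exact: normr_ge0.
have vt : v s @[s --> (x - c) ^+ 2 / 4] --> 0.
  have -> : 0 = v ((x - c) ^+ 2 / 4).
    by rewrite /v mulrCA divff ?pnatr_eq0// mulr1 subrr sqrtr0.
  apply: (@cvg_comp _ _ _ (fun s => (x - c) ^+ 2 - 4 * s) Num.sqrt); last first.
    exact: sqrt_continuous.
  apply: cvgB; first exact: cvg_cst.
  by apply: cvgM; [exact: cvg_cst|exact: cvg_id].
apply: cvg_trans (_ : `|v s| @[s --> (x - c) ^+ 2 / 4] --> 0).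
  by apply: cvg_app; exact: cvg_within.
by rewrite -(normr0 R); exact: cvg_norm vt.
Qed.

Lemma tau_plus_inverse_cst (R : realType) (T : \bar R) (c : R) :
  tau_plus_inverse T (cst c) (fun t => c + 2 * Num.sqrt t).
Proof.
have cc : continuous_driver T (cst c : R -> R).
  by move=> r _ y; exact: cvg_cst.
move=> t /andP[t0 tT].
have [<-|tpos] := eqVneq 0 t.
  rewrite sqrtr0 mulr0 addr0; split => /=; first by rewrite lexx.
    by rewrite /hitting_time eqxx.
  move=> x cx; have [//|xc] := eqVneq x c.
  have lt : c < x by rewrite lt_neqAle eq_sym xc.
  by case/(hitting_time_hits _ cc lt) => -[]; rewrite ltxx.
have {}t0 : 0 < t by rewrite lt_neqAle tpos.
have s0 : 0 < Num.sqrt t by rewrite sqrtr_gt0.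
have lt : c < c + 2 * Num.sqrt t by lra.
split => /=; first exact: ltW.
  apply/(hitting_time_hits _ cc lt); split => //.
  have tE : t = (c + 2 * Num.sqrt t - c) ^+ 2 / 4.
    by have := sqr_sqrtr (ltW t0); rewrite addrC addKr expr2; lra.
  by rewrite [X in hits _ _ X]tE; exact: hits_cst.
move=> x cx Hx; have {cx} cx : c < x.
  rewrite lt_neqAle cx andbT; apply: contraTneq t0 => xc.
  by move: Hx; rewrite /hitting_time xc eqxx => -[->]; rewrite ltxx.
case/(hitting_time_hits _ cc cx): Hx => /(hits_unique _ _ cx (hits_cst cx)) <-.
- have -> : (x - c) ^+ 2 / 4 = ((x - c) / 2) ^+ 2 by field.
  by rewrite sqrtr_sqr ger0_norm; lra.
- by move=> y; exact: cvg_cst.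
- by move=> y; exact: cvg_cst.
Qed.

Lemma tau_minus_inverse_cst (R : realType) (T : \bar R) (c : R) :
  tau_minus_inverse T (cst c) (fun t => c - 2 * Num.sqrt t).
Proof.
apply/tau_minus_inverse_opp.
have -> : \- cst c = cst (- c) :> (R -> R) by [].
have -> : \- (fun t => c - 2 * Num.sqrt t) = (fun t => - c + 2 * Num.sqrt t).
  by apply/funext => t /=; rewrite opprB addrC.
exact: tau_plus_inverse_cst.
Qed.

Lemma sup_norm_cst (R : realType) (T : \bar R) (f : R -> R) (a : R) :
  (0 < T)%E -> (forall t, f t = a) -> sup_norm T f = `|a|%:E.
Proof.
move=> T0 fa; rewrite /sup_norm.
have -> : [set `|f t|%:E | t in time_set T] = [set `|a|%:E].
  apply/seteqP; split=> [_ [t _ <-]|_ ->]; first by rewrite fa.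
  by exists 0; rewrite ?fa// /time_set /= lexx ltW.
exact: ereal_sup1.
Qed.

Theorem theorem3p8 (R : realType) (T : \bar R) (hT : (0 < T)%E) :
  (forall xi xi' : R -> R,
     simple_curve_driver T xi -> simple_curve_driver T xi' ->
     (forall f f' : R -> R,
        tau_plus_inverse T xi f -> tau_plus_inverse T xi' f' ->
        (sup_norm T (fun t => f t - f' t)%R <=
         sup_norm T (fun t => xi t - xi' t)%R)%E) /\
     (forall f f' : R -> R,
        tau_minus_inverse T xi f -> tau_minus_inverse T xi' f' ->
        (sup_norm T (fun t => f t - f' t)%R <=
         sup_norm T (fun t => xi t - xi' t)%R)%E)) /\
  (forall C : R, C < 1 ->
     ~ (forall xi xi' f f' : R -> R,
          simple_curve_driver T xi -> simple_curve_driver T xi' ->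
          tau_plus_inverse T xi f -> tau_plus_inverse T xi' f' ->
          (sup_norm T (fun t => f t - f' t)%R <=
           C%:E * sup_norm T (fun t => xi t - xi' t)%R)%E) /\
     ~ (forall xi xi' f f' : R -> R,
          simple_curve_driver T xi -> simple_curve_driver T xi' ->
          tau_minus_inverse T xi f -> tau_minus_inverse T xi' f' ->
          (sup_norm T (fun t => f t - f' t)%R <=
           C%:E * sup_norm T (fun t => xi t - xi' t)%R)%E)).
Proof.
split=> [xi xi' Hxi Hxi'|C C1].
  have cxi := simple_curve_driver_continuous hT Hxi.
  have cxi' := simple_curve_driver_continuous hT Hxi'.
  by split=> f f'; [exact: tau_plus_inverse_lipschitz
                   |exact: tau_minus_inverse_lipschitz].
have D0 := simple_curve_driver_cst 0 hT; have D1 := simple_curve_driver_cst 1 hT.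
have contra (f f' : R -> R) : (forall t, f' t - f t = 1) ->
    ~ (sup_norm T (fun t => f' t - f t)%R <=
       C%:E * sup_norm T (fun t => cst 1 t - cst 0 t)%R)%E.
  move=> H; rewrite (sup_norm_cst hT H) (@sup_norm_cst _ _ _ 1 hT).
    by rewrite normr1 mule1 lee_fin leNgt C1.
  by move=> t; rewrite subr0.
split=> H.
- have := H _ _ _ _ D1 D0 (@tau_plus_inverse_cst R T 1) (@tau_plus_inverse_cst R T 0).
  by apply: contra => t; ring.
- have := H _ _ _ _ D1 D0 (@tau_minus_inverse_cst R T 1) (@tau_minus_inverse_cst R T 0).
  by apply: contra => t; ring.
Qed.
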